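(* Let $T$ be a binary tree. Its Tamari polynomial $\mathcal{B}_T(x)$ counts the trees smaller than or equal to $T$ in the Tamari order according to the number of nodes on their leftmost branch, i.e. $\mathcal{B}_T(x)=\sum_{T'\le T}x^{\ell(T')}$, where $\ell(T')$ is the number of nodes on the leftmost branch of $T'$. In particular, $\mathcal{B}_T(1)$ is the number of trees smaller than or equal to $T$. Symmetrically, the polynomial $\tilde{\mathcal{B}}_T(x)$, obtained by exchanging the roles of left and right children in the definition of $\mathcal{B}_T$, counts the trees greater than or equal to $T$ according to the number of nodes on their right border, i.e. $\tilde{\mathcal{B}}_T(x)=\sum_{T'\ge T}x^{r(T')}$, where $r(T')$ is the number of nodes on the right border of $T'$.
   Context: A binary tree is planar: it is either the empty tree $\emptyset$ or a root node with an ordered pair (left subtree, right subtree) of binary trees; $x(A,B)$ denotes the tree with root $x$, left subtree $A$, right subtree $B$. The size is the number of nodes. A right rotation replaces, somewhere inside a tree, a subtree $y(x(A,B),C)$ by $x(A,y(B,C))$ ($A,B,C$ possibly empty). The Tamari order on binary trees of size $n$ is the reflexive transitive closure of right rotation: $T\le T'$ iff $T'$ is obtained from $T$ by a (possibly empty) sequence of right rotations. The leftmost branch (resp. right border) of a tree consists of the nodes reached from the root by following only left (resp. right) edges, root included; it has $0$ nodes for the empty tree. Tamari polynomials are defined recursively by $\mathcal{B}_\emptyset:=1$ and, for a nonempty tree $T$ with left subtree $L$ and right subtree $R$, $$\mathcal{B}_T(x):=x\,\mathcal{B}_L(x)\,\frac{x\,\mathcal{B}_R(x)-\mathcal{B}_R(1)}{x-1}.$$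 Explicitly, $\tilde{\mathcal{B}}_\emptyset:=1$ and $\tilde{\mathcal{B}}_T(x):=x\,\tilde{\mathcal{B}}_R(x)\,\frac{x\,\tilde{\mathcal{B}}_L(x)-\tilde{\mathcal{B}}_L(1)}{x-1}$. *)

(* Defs.v *)
From HB Require Import structures.
From Stdlib Require Import Relation_Operators.
From mathcomp Require Import all_boot all_order all_algebra finmap.
From mathcomp Require Import boolp classical_sets functions cardinality fsbigop.

Set Implicit Arguments.
Unset Strict Implicit.
Unset Printing Implicit Defensive.

Import GRing.Theory.
Local Open Scope ring_scope.

(* Trees are unlabelled: [Node A B] is x(A, B), x being a mere node name. *)
Inductive btree : Type :=
| Empty : btree
| Node : btree -> btree -> btree.

Fixpoint gentree_of_btree (T : btree) : GenTree.tree unit :=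
  if T is Node L R
  then GenTree.Node 0 [:: gentree_of_btree L; gentree_of_btree R]
  else GenTree.Leaf tt.

Fixpoint btree_of_gentree (t : GenTree.tree unit) : btree :=
  if t is GenTree.Node _ [:: l; r]
  then Node (btree_of_gentree l) (btree_of_gentree r)
  else Empty.

Lemma gentree_of_btreeK : cancel gentree_of_btree btree_of_gentree.
Proof. by elim=> [//|L IHL R IHR] /=; rewrite IHL IHR. Qed.

HB.instance Definition _ := Countable.copy btree (can_type gentree_of_btreeK).

Inductive right_rotation : btree -> btree -> Prop :=
| rotation_root A B C :
    right_rotation (Node (Node A B) C) (Node A (Node B C))
| rotation_left L L' R :
    right_rotation L L' -> right_rotation (Node L R) (Node L' R)
| rotation_right L R R' :
    right_rotation R R' -> right_rotation (Node L R) (Node L R').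

(* Right rotations preserve the number of nodes, so this single relation
   restricts to the Tamari order on the trees of each size, and trees of
   different sizes are never comparable. *)
Definition tamari_le : btree -> btree -> Prop :=
  clos_refl_trans btree right_rotation.

Fixpoint leftmost_branch (T : btree) : nat :=
  if T is Node L _ then (leftmost_branch L).+1 else 0.

Fixpoint right_border (T : btree) : nat :=
  if T is Node _ R then (right_border R).+1 else 0.

(* (x P(x) - P(1)) / (x - 1); the division is exact by [tamari_divK]. *)
Definition tamari_div (P : {poly int}) : {poly int} :=
  ('X * P - P.[1]%:P) %/ ('X - 1).

Lemma tamari_divK (P : {poly int}) :
  ('X - 1) * tamari_div P = 'X * P - P.[1]%:P.
Proof.
have rt : root ('X * P - P.[1]%:P) 1.
  by rewrite /root hornerD hornerN hornerM hornerX hornerC mul1r subrr.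
have [q Eq] := factor_theorem _ _ rt.
rewrite /tamari_div Eq -polyC1 Pdiv.IdomainMonic.mulpK ?monicXsubC //.
exact: mulrC.
Qed.

Fixpoint tamari_poly (T : btree) : {poly int} :=
  if T is Node L R
  then 'X * tamari_poly L * tamari_div (tamari_poly R)
  else 1.

Fixpoint dual_tamari_poly (T : btree) : {poly int} :=
  if T is Node L R
  then 'X * dual_tamari_poly R * tamari_div (dual_tamari_poly L)
  else 1.

(* Main.v *)
Require Import Defs.
From mathcomp Require Import all_boot all_order all_algebra finmap.
From mathcomp Require Import boolp classical_sets functions cardinality fsbigop.
From Stdlib Require Import Relation_Operators Operators_Properties.
From mathcomp Require Import zify.

Set Implicit Arguments.
Unset Strict Implicit.
Unset Printing Implicit Defensive.

Import GRing.Theory.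
Local Open Scope classical_set_scope.
Local Open Scope ring_scope.

(** Write [l T] for the number of nodes on the leftmost branch of [T].

    The trees below [x(L, R)] are obtained by choosing [L'] below [L] and [R']
    below [R], and inserting the node [x], with left subtree [L'], somewhere
    on the leftmost branch of [R'] ([tamari_le_NodeP]).  Such trees are below
    [x(L, R)] because right rotations slide [x] up to the root, and every
    lower tree has this form because the form is preserved by left rotations
    ([insertions_left_rotation]).  The choice is determined by the resulting
    tree ([insertions_inj]): rotations preserve the inorder numbering of the
    nodes, so [x] is the node preceded by [node_count L] others.

    There are [l R' + 1] insertion points; inserting under [i] nodes of the
    branch gives a leftmost branch with [l L' + 1 + i] nodes.  Hence [(L', R')]
    contributes [x^(l L' + 1) (1 + x + ... + x^(l R'))], and the second factor
    is [(x x^(l R') - 1) / (x - 1)], the value of [tamari_div] on [x^(l R')]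
    ([insertions_gf]).  As [tamari_div] is additive, summing over [L'] and
    [R'] yields the recursion that defines [tamari_poly].

    Exchanging left and right reverses right rotations, hence the order, and
    exchanges the two families of polynomials; this gives the statement on
    upper sets. *)

(** * The Tamari order as a closure *)

Lemma tamari_le_refl T : tamari_le T T.
Proof. exact: rt_refl. Qed.

Lemma tamari_le_trans U S T : tamari_le S U -> tamari_le U T -> tamari_le S T.
Proof. exact: rt_trans. Qed.

Lemma tamari_le_homo (f : btree -> btree) :
    (forall S T, right_rotation S T -> right_rotation (f S) (f T)) ->
  forall S T, tamari_le S T -> tamari_le (f S) (f T).
Proof.
move=> f_homo S T; elim=> [{}S {}T /f_homo|{}S|{}S U {}T _ IH1 _ IH2].
- exact: rt_step.
- exact: rt_refl.
- exact: tamari_le_trans IH1 IH2.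
Qed.

Lemma tamari_le_Node L L' R R' :
  tamari_le L L' -> tamari_le R R' -> tamari_le (Node L R) (Node L' R').
Proof.
move=> leL leR; apply: (@tamari_le_trans (Node L' R)).
  by apply: (tamari_le_homo (f := Node^~ R)) leL => S T; exact: rotation_left.
by apply: (tamari_le_homo (f := Node L')) leR => S T; exact: rotation_right.
Qed.

Fixpoint node_count (T : btree) : nat :=
  if T is Node L R then (node_count L + node_count R).+1 else 0%N.

Lemma tamari_le_node_count S T : tamari_le S T -> node_count S = node_count T.
Proof.
elim=> [{}S {}T|//|{}S U {}T _ -> _ //].
by elim=> [A B C|L L' R _ IH|L R R' _ IH] /=; lia.
Qed.

(** * Lower sets of the Tamari order *)

(** The trees obtained by inserting a new node with left subtree [L] on the
    leftmost branch of [R]: the nodes of that branch above the insertion point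
    stay above the new node, and the rest of [R] becomes its right subtree.
    They form the chain read from [Node L R] downwards when its root is
    repeatedly rotated back below its right child. *)
Fixpoint insertions (L R : btree) : seq btree :=
  Node L R :: if R is Node A B then [seq Node X B | X <- insertions L A] else [::].

Variant insertions_spec L R X : Prop :=
| InsertionRoot of X = Node L R
| InsertionBelow A B Y of R = Node A B & X = Node Y B & Y \in insertions L A.

Lemma insertionsP L R X : reflect (insertions_spec L R X) (X \in insertions L R).
Proof.
apply: (iffP idP) => [|[->|A B Y -> -> YA]].
- case: R => [|A B] /=; rewrite in_cons => /predU1P[->|//]; try by left.
  by move=> /mapP[Y YA ->]; apply: (@InsertionBelow _ _ _ A B Y).
- by case: R => [|A B]; rewrite inE eqxx.
- by rewrite /= inE map_f ?orbT.
Qed.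

Lemma insertions_root L R : Node L R \in insertions L R.
Proof. by apply/insertionsP; left. Qed.

Lemma insertions_below L A B Y :
  Y \in insertions L A -> Node Y B \in insertions L (Node A B).
Proof. by move=> YA; apply/insertionsP; right with A B Y. Qed.

Lemma insertions_le L R X : X \in insertions L R -> tamari_le X (Node L R).
Proof.
elim: R X => [|A IHA B _] X /insertionsP[->|A' B' Y // [<- <-] -> YA];
  try exact: tamari_le_refl.
apply: (@tamari_le_trans (Node (Node L A) B)).
  exact: tamari_le_Node (IHA _ YA) (tamari_le_refl _).
by apply: rt_step; exact: rotation_root.
Qed.

Variant rotation_to_Node_spec A B U : Prop :=
| RotationRoot P Q of B = Node P Q & U = Node (Node A P) Q
| RotationLeft A' of right_rotation A' A & U = Node A' B
| RotationRight B' of right_rotation B' B & U = Node A B'.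

Lemma rotation_to_NodeP A B U :
  right_rotation U (Node A B) -> rotation_to_Node_spec A B U.
Proof.
move=> rotU; inversion rotU; subst.
- exact: RotationRoot erefl erefl.
- by apply: RotationLeft erefl.
- by apply: RotationRight erefl.
Qed.

(** Insertions are stable under left rotation, up to going down in [L] and
    [R].  Apart from rotations inside [L] or [R], the rotated edge can be the
    right edge leaving the inserted node, which moves the insertion point one
    step down, or the right edge leaving a node of the branch above it; the
    latter is also an edge of [R]. *)
Lemma insertions_left_rotation L R X U :
    X \in insertions L R -> right_rotation U X ->
  exists L' R', [/\ tamari_le L' L, tamari_le R' R & U \in insertions L' R'].
Proof.
have at_root S U' : right_rotation U' (Node L S) ->
    exists L' S', [/\ tamari_le L' L, tamari_le S' S & U' \in insertions L' S'].
  move=> /rotation_to_NodeP[P Q -> ->|L' rotL ->|S' rotS ->].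
  - exists L, (Node P Q); split; [exact: tamari_le_refl..|].
    exact/insertions_below/insertions_root.
  - exists L', S; split; [exact: rt_step|exact: tamari_le_refl|].
    exact: insertions_root.
  - exists L, S'; split; [exact: tamari_le_refl|exact: rt_step|].
    exact: insertions_root.
elim: R X U => [|A IHA B _] X U /insertionsP[->|A' B' Y // [<- <-] -> YA];
  try exact: at_root.
move=> /rotation_to_NodeP[P Q -> ->|Z rotZ ->|B1 rotB ->].
- exists L, (Node (Node A P) Q); split; [exact: tamari_le_refl| |].
    by apply: rt_step; exact: rotation_root.
  exact/insertions_below/insertions_below.
- have [L1 [A1 [leL leA ZA]]] := IHA _ _ YA rotZ.
  exists L1, (Node A1 B); split=> //; last exact: insertions_below.
  exact: tamari_le_Node leA (tamari_le_refl _).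
- exists L, (Node A B1); split; [exact: tamari_le_refl| |].
    by apply: rt_step; exact: rotation_right.
  exact: insertions_below.
Qed.

Lemma tamari_le_NodeP L R X :
  tamari_le X (Node L R) <->
  exists L' R', [/\ tamari_le L' L, tamari_le R' R & X \in insertions L' R'].
Proof.
split=> [leX|[L' [R' [leL leR XI]]]]; last first.
  exact: tamari_le_trans (insertions_le XI) (tamari_le_Node leL leR).
move def_T: (Node L R) leX => T /(clos_rt_rt1n _ _ _ _) leX.
elim: leX def_T => [{}X <-|{}X Y {}T rotX _ IH /IH[L1 [R1 [leL leR YI]]]].
  by exists L, R; split; [exact: tamari_le_refl..|exact: insertions_root].
have [L2 [R2 [leL2 leR2 XI]]] := insertions_left_rotation YI rotX.
by exists L2, R2; split=> //; [exact: tamari_le_trans leL2 leL|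
  exact: tamari_le_trans leR2 leR].
Qed.

Fixpoint lower_trees (T : btree) : seq btree :=
  if T is Node L R then
    [seq X | P <- [seq (L', R') | L' <- lower_trees L, R' <- lower_trees R],
             X <- insertions P.1 P.2]
  else [:: Defs.Empty].

Lemma mem_lower_trees T X : X \in lower_trees T <-> tamari_le X T.
Proof.
elim: T X => [|L IHL R IHR] X.
  rewrite inE; split=> [/eqP->|/tamari_le_node_count]; last by case: X.
  exact: tamari_le_refl.
rewrite tamari_le_NodeP; split.
  move=> /allpairsPdep[_ [Y [/allpairsP[[L' R'] [/= L'L R'R ->]] YI ->]]].
  by exists L', R'; split=> //; [apply/IHL|apply/IHR].
move=> [L' [R' [/IHL leL /IHR leR XI]]].
apply/allpairsPdep; exists (L', R'), X; split=> //.
by apply/allpairsP; exists (L', R').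
Qed.

(** * Absence of repetitions *)

Lemma insertions_node_count L R X :
  X \in insertions L R -> node_count X = (node_count L + node_count R).+1.
Proof. by move=> /insertions_le/tamari_le_node_count ->. Qed.

Lemma insertions_uniq L R : uniq (insertions L R).
Proof.
elim: R => [|A IHA B _] //=; rewrite map_inj_uniq ?IHA ?andbT; last first.
  by move=> X Y [].
by apply/mapP=> -[Y /insertions_node_count cY [eqL _]]; move: cY; rewrite -eqL; lia.
Qed.

(** The inserted node is the one whose rank in the inorder traversal is
    [(node_count L).+1], so it can be located from the size of [L] alone;
    deleting it recovers [L] and [R]. *)
Lemma insertions_inj L1 R1 L2 R2 X :
    node_count L1 = node_count L2 ->
    X \in insertions L1 R1 -> X \in insertions L2 R2 ->
  L1 = L2 /\ R1 = R2.
Proof.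
move=> eqL; elim: R1 R2 X => [|A IHA B _] R2 X.
all: move=> /insertionsP[->|A1 B1 Y1 // [<- <-] -> Y1A].
all: move=> /insertionsP[[]|A2 B2 Y2 -> [] eqY eqB Y2A] //.
(* If the two insertion points differ, one of [L1] and [L2] contains an
   insertion of the other and is therefore strictly larger. *)
- by move: (insertions_node_count Y2A); rewrite -eqY; lia.
- by move: (insertions_node_count Y2A); rewrite -eqY; lia.
- by move=> eqY; move: (insertions_node_count Y1A); rewrite eqY; lia.
- rewrite -eqY in Y2A; have [-> ->] := IHA _ _ Y1A Y2A.
  by rewrite eqB.
Qed.

Lemma lower_trees_uniq T : uniq (lower_trees T).
Proof.
elim: T => [//|L IHL R IHR] /=; apply: allpairs_uniq_dep.
- by apply: allpairs_uniq => // -[? ?] [? ?].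
- by move=> P _; exact: insertions_uniq.
move=> p q /allpairsPdep[P1 [X1 [P1_in X1_in ->]]].
move=> /allpairsPdep[P2 [X2 [P2_in X2_in ->]]] /= eqX.
rewrite -{}eqX in X2_in *; suff -> : P1 = P2 by [].
case/allpairsP: P1_in X1_in => -[L1 R1] [/= L1_in _ ->] /= X1_in.
case/allpairsP: P2_in X2_in => -[L2 R2] [/= L2_in _ ->] /= X2_in.
have eq_count : node_count L1 = node_count L2.
  move/mem_lower_trees/tamari_le_node_count: L1_in => ->.
  by move/mem_lower_trees/tamari_le_node_count: L2_in => ->.
by have [-> ->] := insertions_inj eq_count X1_in X2_in.
Qed.

(** * Generating polynomials *)

(** Cancelling [x - 1] turns the divisibility identity into a
    characterisation, through which [tamari_div] is computed below. *)
Lemma tamari_div_eq (P Q : {poly int}) :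
  ('X - 1) * Q = 'X * P - P.[1]%:P -> tamari_div P = Q.
Proof.
move=> defQ; apply: (@mulfI _ ('X - 1)); last by rewrite tamari_divK.
by rewrite -polyC1 polyXsubC_eq0.
Qed.

Lemma tamari_div_sum (I : Type) (s : seq I) (F : I -> {poly int}) :
  tamari_div (\sum_(i <- s) F i) = \sum_(i <- s) tamari_div (F i).
Proof.
apply: tamari_div_eq; rewrite !mulr_sumr horner_sum rmorph_sum /= -sumrB.
by apply: eq_bigr => i _; exact: tamari_divK.
Qed.

Lemma tamari_div1 : tamari_div 1 = 1.
Proof. by apply: tamari_div_eq; rewrite -[in X in X.[1]]polyC1 hornerC polyC1 !mulr1. Qed.

Lemma tamari_divXnS n : tamari_div 'X^(n.+1) = 1 + 'X * tamari_div 'X^n.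
Proof.
apply: tamari_div_eq.
rewrite mulrDr mulr1 mulrCA tamari_divK !hornerXn !expr1n polyC1 mulrBr mulr1.
by rewrite addrC addrA subrK -exprS.
Qed.

(** The inserted node can be given any number, from [0] to the length of the
    leftmost branch of [R], of ancestors on that branch. *)
Lemma insertions_gf L R :
  \sum_(X <- insertions L R) 'X^(leftmost_branch X) =
  'X^((leftmost_branch L).+1) * tamari_div 'X^(leftmost_branch R) :> {poly int}.
Proof.
elim: R => [|A IHA B _] /=; first by rewrite big_seq1 expr0 tamari_div1 mulr1.
rewrite big_cons big_map /= tamari_divXnS mulrDr mulr1 mulrCA -IHA mulr_sumr.
by congr (_ + _); apply: eq_bigr => X _; rewrite exprS.
Qed.

Lemma tamari_polyE T :
  tamari_poly T = \sum_(X <- lower_trees T) 'X^(leftmost_branch X).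
Proof.
elim: T => [|L IHL R IHR] /=; first by rewrite big_seq1.
rewrite big_allpairs_dep big_allpairs IHL IHR tamari_div_sum.
rewrite -mulrA mulr_suml mulr_sumr; apply: eq_bigr => L' _.
rewrite !mulr_sumr; apply: eq_bigr => R' _ /=.
by rewrite insertions_gf exprS mulrA.
Qed.

(** * Left-right symmetry *)

Fixpoint mirror (T : btree) : btree :=
  if T is Node L R then Node (mirror R) (mirror L) else Defs.Empty.

Lemma mirrorK : involutive mirror.
Proof. by elim=> [//|L IHL R IHR] /=; rewrite IHL IHR. Qed.

Lemma mirror_rotation S T : right_rotation S T -> right_rotation (mirror T) (mirror S).
Proof.
elim=> [A B C|L L' R _ IH|L R R' _ IH] /=.
- exact: rotation_root.
- exact: rotation_right.
- exact: rotation_left.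
Qed.

Lemma mirror_le S T : tamari_le (mirror T) (mirror S) <-> tamari_le S T.
Proof.
have le_mirror U V : tamari_le U V -> tamari_le (mirror V) (mirror U).
  elim=> [{}U {}V /mirror_rotation|{}U|{}U W {}V _ IH1 _ IH2].
  - exact: rt_step.
  - exact: rt_refl.
  - exact: tamari_le_trans IH2 IH1.
by split=> /le_mirror; rewrite ?mirrorK.
Qed.

Lemma leftmost_branch_mirror T : leftmost_branch (mirror T) = right_border T.
Proof. by elim: T => [//|L _ R IH] /=; rewrite IH. Qed.

Lemma tamari_poly_mirror T : tamari_poly (mirror T) = dual_tamari_poly T.
Proof. by elim: T => [//|L IHL R IHR] /=; rewrite IHL IHR. Qed.

(** * Counting lower and upper sets *)

Theorem theorem1p2 (T : btree) :
  [/\ finite_set [set T' | tamari_le T' T],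
      tamari_poly T =
        \sum_(T' \in [set T' | tamari_le T' T]) ('X^(leftmost_branch T') : {poly int}),
      (tamari_poly T).[1] = #|` fset_set [set T' | tamari_le T' T]|%:R,
      finite_set [set T' | tamari_le T T'] &
      dual_tamari_poly T =
        \sum_(T' \in [set T' | tamari_le T T']) ('X^(right_border T') : {poly int})].
Proof.
have lowerE : [set T' | tamari_le T' T] = [set` lower_trees T].
  by apply/seteqP; split=> X /= /mem_lower_trees.
have upperE : [set T' | tamari_le T T'] = [set` map mirror (lower_trees (mirror T))].
  apply/seteqP; split=> X /=.
    move=> /mirror_le/mem_lower_trees leX; apply/mapP; exists (mirror X) => //.
    by rewrite mirrorK.
  move=> /mapP[Y /mem_lower_trees leY ->]; apply/mirror_le.
  by rewrite mirrorK.
have upper_uniq : uniq (map mirror (lower_trees (mirror T))).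
  by rewrite (map_inj_uniq (inv_inj mirrorK)) lower_trees_uniq.
rewrite lowerE upperE; split.
- exact: finite_seq.
- by rewrite -fsbig_seq ?lower_trees_uniq // tamari_polyE.
- have -> : [set` lower_trees T] = [set` [fset X in lower_trees T]%fset].
    by apply/seteqP; split=> X /=; rewrite !inE.
  rewrite set_fsetK card_fseq undup_id ?lower_trees_uniq // tamari_polyE horner_sum.
  under eq_bigr do rewrite hornerXn expr1n.
  by rewrite big_const_seq count_predT iter_addr_0.
- exact: finite_seq.
- rewrite -fsbig_seq // big_map -tamari_poly_mirror tamari_polyE.
  by apply: eq_bigr => X _; rewrite -leftmost_branch_mirror mirrorK.
Qed.
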